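(* Let $p\in(0,1)$ and $\beta\ge0$. For $\alpha\in\mathbb R$ and $W\in\mathcal W$ let \[ \Phi_{\alpha,\beta}(W):=\alpha\,e(W)+\beta\,t(W)-I(W). \] If the constant graphon $W\equiv p$ is a global maximizer of $\Phi_{\alpha,\beta}$ over $\mathcal W$ for some $\alpha$, then necessarily \[ \alpha=\frac12\log\frac{p}{1-p}-2\beta p . \] For this value of $\alpha$, the following hold: 1. if $\beta<c_p/2$, then $W\equiv p$ is the unique global maximizer; 2. if $\beta=c_p/2$, then $W\equiv p$ is a global maximizer, and it is unique if and only if $p=1/2$; 3. if $\beta>c_p/2$, then $W\equiv p$ is not a global maximizer.
   Context: $\mathcal W$ is the space of symmetric measurable functions $W:[0,1]^2\to[0,1]$ (functions equal almost everywhere are identified, so uniqueness is up to almost everywhere equality). For $W\in\mathcal W$, \[ e(W)=\int_{[0,1]^2}W(x,y)\,dx\,dy,\qquad t(W)=\int_0^1\Big[\int_0^1W(x,y)\,dy\Big]^2dx, \] \[ I(W)=\frac12\int_{[0,1]^2}\big[W\log W+(1-W)\log(1-W)\big]\,dx\,dy,\qquad 0\log0=0 . \] $c_p=\frac{\log(p/(1-p))}{2p-1}$ for $p\ne\frac12$, and $c_{1/2}=2$. *)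

(* Defs.v *)
From HB Require Import structures.
From mathcomp Require Import all_boot all_order all_algebra.
From mathcomp Require Import all_classical all_reals all_analysis.
Set Implicit Arguments.
Unset Strict Implicit.
Unset Printing Implicit Defensive.
Import Order.TTheory GRing.Theory Num.Theory.
Local Open Scope classical_set_scope.
Local Open Scope ring_scope.

Section Graphons.
Variable R : realType.

Local Notation lambda := (@lebesgue_measure R).
Local Notation lambda2 := (lambda \x lambda)%E.

Definition unit_interval : set R := `[0, 1].

Definition unit_square : set (R * R) := unit_interval `*` unit_interval.

(* A graphon is a function on the whole plane, constrained only on the unit
   square; its values outside the square are irrelevant everywhere below.
   [measurableTypeR R] is R with its Borel sets, the domain of [lambda]. *)
Definition graphon (W : R * R -> R) : Prop :=
  [/\ measurable_fun
         (unit_square : set (measurableTypeR R * measurableTypeR R)) W,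
      (forall x y, unit_square (x, y) -> W (x, y) = W (y, x)) &
      (forall z, unit_square z -> 0 <= W z <= 1)].

(* Equality of graphons as elements of the quotient by a.e. equality. *)
Definition graphon_eq (W V : R * R -> R) : Prop :=
  ae_eq lambda2 unit_square W V.

(* For graphons, all the integrands below are bounded and measurable, so the
   real-valued integral [Rintegral] never takes a junk value. *)
Definition edge_density (W : R * R -> R) : R :=
  \int[lambda2]_(z in unit_square) W z.

Definition two_star_density (W : R * R -> R) : R :=
  \int[lambda]_(x in unit_interval)
    (\int[lambda]_(y in unit_interval) W (x, y)) ^+ 2.

(* The convention 0 log 0 = 0 holds because [ln 0 = 0] in the library. *)
Definition entropy (W : R * R -> R) : R :=
  2^-1 * \int[lambda2]_(z in unit_square)
    (W z * ln (W z) + (1 - W z) * ln (1 - W z)).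

Definition Phi (alpha beta : R) (W : R * R -> R) : R :=
  alpha * edge_density W + beta * two_star_density W - entropy W.

Definition global_maximizer (alpha beta : R) (W : R * R -> R) : Prop :=
  graphon W /\ forall V, graphon V -> Phi alpha beta V <= Phi alpha beta W.

Definition unique_maximizer (alpha beta : R) (W : R * R -> R) : Prop :=
  global_maximizer alpha beta W /\
  forall V, global_maximizer alpha beta V -> graphon_eq V W.

Definition critical_c (p : R) : R :=
  if p == 2^-1 then 2 else ln (p / (1 - p)) / (2 * p - 1).

End Graphons.

(* Main.v *)
Require Import Defs.
From HB Require Import structures.
From mathcomp Require Import all_boot all_order all_algebra.
From mathcomp Require Import all_classical all_reals all_analysis.
From mathcomp Require Import measurable_realfun.
From mathcomp Require Import ring lra.
Import Order.TTheory GRing.Theory Num.Theory.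
Import numFieldNormedType.Exports.
Local Open Scope classical_set_scope.
Local Open Scope ring_scope.

(* Jensen's inequality on the sections of W bounds t(W) by the integral of W^2,
   so for beta >= 0 the functional Phi(W) is at most the integral of f(W) for the
   scalar function f(w) = alpha w + beta w^2 - (w log w + (1-w) log (1-w)) / 2,
   with equality for constant W. Hence the constant p is a maximizer iff p
   maximizes f over [0,1]; f'(p) = 0 forces alpha. For that alpha, with c = c_p,
     f(p) - f(w) = (g(w) - g(p)) / 2 + (c/2 - beta) (w - p)^2,
   where g(w) = w log w + (1-w) log (1-w) - c (w - 1/2)^2 is symmetric about 1/2
   and minimal exactly at p and 1 - p: on (1/2,1) the sign of
   g'(w) = log (w/(1-w)) - c (2w - 1) is governed by strict convexity of
   log (w/(1-w)). *)

(** * Derivatives of the logit and of the entropy *)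

Section Calculus.
Context {R : realType}.
Implicit Types a b c p q w x y : R.

Definition logit x : R := ln x - ln (1 - x).

Definition negentropy x : R := x * ln x + (1 - x) * ln (1 - x).

(** The parameter [c] is left free: besides [critical_c p], the value [2 * beta] is used in
    [point_value_not_max]. Centring the square at 1/2 keeps the symmetry under x -> 1 - x for every
    [c]. *)
Definition gap c x : R := negentropy x - c * (x - 2^-1) ^+ 2.

Lemma MVT_derivable (f df : R -> R) a b : a < b ->
  (forall x, a <= x <= b -> is_derive x 1 f (df x)) ->
  exists2 x, a < x < b & f b - f a = df x * (b - a).
Proof.
move=> ab fdf; have [x|y|x xab e] := @MVT R f df a b ab.
- by rewrite in_itv/= => /andP[ax xb]; apply: fdf; rewrite !ltW.
- apply: derivable_within_continuous => z; rewrite in_itv/= => zab.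
  exact: (@ex_derive _ _ _ _ _ _ _ (fdf z zab)).
- by exists x => //; move: xab; rewrite in_itv.
Qed.

Lemma logit_div p : 0 < p -> p < 1 -> ln (p / (1 - p)) = logit p.
Proof. by move=> p0 p1; rewrite ln_div// posrE; lra. Qed.

Lemma logit_onem x : logit (1 - x) = - logit x.
Proof. by rewrite /logit subKr opprB. Qed.

Lemma logit_half : logit 2^-1 = 0 :> R.
Proof. by apply/eqP; rewrite subr_eq0; apply/eqP; congr ln; lra. Qed.

Lemma negentropy_onem x : negentropy (1 - x) = negentropy x.
Proof. by rewrite /negentropy addrC subKr. Qed.

Lemma negentropy1 : negentropy 1 = 0.
Proof. by rewrite /negentropy subrr ln1 mulr0 mul0r addr0. Qed.

Lemma negentropy_le0 x : 0 <= x <= 1 -> negentropy x <= 0.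
Proof.
move=> /andP[x0 x1]; rewrite -(addr0 0); apply: lerD.
  by rewrite mulr_ge0_le0// ln_le0.
by rewrite mulr_ge0_le0 ?ln_le0//; lra.
Qed.

Lemma gap_onem c x : gap c (1 - x) = gap c x.
Proof. by rewrite /gap negentropy_onem; field. Qed.

Lemma is_derive_ln_onem x : x < 1 ->
  is_derive x 1 (fun y => ln (1 - y)) (- (1 - x)^-1).
Proof.
move=> x1.
have d1 : is_derive x 1 (fun y : R => 1 - y) (-1).
  by apply: is_derive_eq; ring.
have d2 : is_derive (1 - x) 1 (@ln R) (1 - x)^-1.
  by apply: is_derive1_ln; lra.
have := @is_derive1_comp _ (@ln R) (fun y => 1 - y) x _ _ d2 d1; rewrite mulrN1.
exact.
Qed.

Lemma is_derive_logit x : 0 < x < 1 ->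
  is_derive x 1 logit (x * (1 - x))^-1.
Proof.
move=> /andP[x0 x1].
have d1 := is_derive1_ln x0; have d2 := is_derive_ln_onem x x1.
rewrite (_ : _^-1 = x^-1 - - (1 - x)^-1); last by field; lra.
exact: is_deriveB.
Qed.

Lemma is_derive_negentropy x : 0 < x < 1 ->
  is_derive x 1 negentropy (logit x).
Proof.
move=> /andP[x0 x1].
have d1 := is_derive1_ln x0; have d2 := is_derive_ln_onem x x1.
have d3 : is_derive x 1 (fun y : R => 1 - y) (-1).
  by apply: is_derive_eq; ring.
have e1 := is_deriveM (is_derive_id x 1) d1.
have e2 := is_deriveM d3 d2.
refine (@is_derive_eq _ _ _ _ _ _ _ _ (is_deriveD e1 e2) _).
by rewrite /logit /GRing.scale/=; field; lra.
Qed.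

Lemma is_derive_gap c x : 0 < x < 1 ->
  is_derive x 1 (gap c) (logit x - c * (2 * x - 1)).
Proof.
move=> x01; have d1 := is_derive_negentropy x x01.
have d2 : is_derive x 1 (fun y : R => c * (y - 2^-1) ^+ 2) (c * (2 * x - 1)).
  apply: is_derive_eq; by rewrite /GRing.scale/=; field.
exact: (is_deriveB d1 d2).
Qed.


(** * Chord slopes of the logit to the right of 1/2 *)

Lemma logit_chord x : 2^-1 < x < 1 ->
  exists2 z, 2^-1 < z < x & logit x = (z * (1 - z))^-1 * (x - 2^-1).
Proof.
move=> /andP[x0 x1].
have [z|z zx] := @MVT_derivable logit (fun z => (z * (1 - z))^-1) _ _ x0.
  by move=> /andP[z0 z1]; apply: is_derive_logit; lra.
by rewrite logit_half subr0 => ->; exists z.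
Qed.

(** This is the strict convexity of [logit] on [1/2, 1): the compared quantities are its
    derivatives, and x (1 - x) decreases there. *)
Lemma ltf_inv_mul_onem x y : 2^-1 <= x -> x < y -> y < 1 ->
  (x * (1 - x))^-1 < (y * (1 - y))^-1.
Proof.
move=> x0 xy y1; have xx : 0 < x * (1 - x) by apply: mulr_gt0; lra.
have yy : 0 < y * (1 - y) by apply: mulr_gt0; lra.
rewrite ltf_pV2 ?posrE//; nra.
Qed.

(** The derivative of [logit] is 4 at 1/2 and larger to the right. This replaces the comparison of
    chords when p = 1/2. *)
Lemma logit_gt_tangent x : 2^-1 < x < 1 -> 4 * (x - 2^-1) < logit x.
Proof.
move=> x01; have [z /andP[z0 zx] ->] := logit_chord x x01.
move/andP: x01 => [x0 x1].
have := @ltf_inv_mul_onem 2^-1 z (lexx _) z0 (lt_trans zx x1).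
rewrite (_ : (2^-1 * _)^-1 = 4) => [h|]; last by field.
by rewrite ltr_pM2r; lra.
Qed.

(* [logit x / (x - 1/2)] is the slope of the chord of [logit] from the
   inflection point 1/2, right of which [logit] is strictly convex. *)
Lemma logit_slope_lt x y : 2^-1 < x -> x < y -> y < 1 ->
  logit x * (y - 2^-1) < logit y * (x - 2^-1).
Proof.
move=> x0 xy y1.
have [|z /andP[z0 zx] ex] := logit_chord x; first by lra.
have [z'|z' /andP[xz zy] ey] :=
    @MVT_derivable logit (fun z => (z * (1 - z))^-1) _ _ xy.
  by move=> /andP[z1 z2]; apply: is_derive_logit; lra.
have h := @ltf_inv_mul_onem z z' (ltW z0) (lt_trans zx xz) (lt_trans zy y1).
rewrite -subr_gt0.
have -> : logit y * (x - 2^-1) - logit x * (y - 2^-1) =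
  ((z' * (1 - z'))^-1 - (z * (1 - z))^-1) * ((y - x) * (x - 2^-1)).
  have -> : logit y = (z' * (1 - z'))^-1 * (y - x) + logit x.
    by rewrite -ey subrK.
  by rewrite ex; ring.
by rewrite mulr_gt0 ?mulr_gt0//; lra.
Qed.

Lemma gap_min_ge_half c q x : 0 < c -> 2^-1 <= q < 1 ->
  (forall w, 2^-1 < w -> w < q -> logit w < c * (2 * w - 1)) ->
  (forall w, q < w -> w < 1 -> c * (2 * w - 1) < logit w) ->
  2^-1 <= x <= 1 -> x != q -> gap c q < gap c x.
Proof.
move=> c0 /andP[q0 q1] lo hi /andP[x0 x1] xq.
have dgap y : 0 < y < 1 -> is_derive y 1 (gap c) (logit y - c * (2 * y - 1)).
  exact: is_derive_gap.
have up y z : q <= y -> y < z -> z < 1 -> gap c y < gap c z.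
  move=> qy yz z1; have [w|w /andP[yw wz] e] :=
    @MVT_derivable (gap c) (fun y => logit y - c * (2 * y - 1)) _ _ yz.
    by move=> yz1; apply: dgap; lra.
  rewrite -subr_gt0 e mulr_gt0 ?subr_gt0//; apply: hi; lra.
have [xltq|qltx|/eqP] := ltgtP x q; last by rewrite (negPf xq).
  have [w|w /andP[yw wz] e] :=
    @MVT_derivable (gap c) (fun y => logit y - c * (2 * y - 1)) _ _ xltq.
    by move=> yz1; apply: dgap; lra.
  rewrite -subr_lt0 e pmulr_llt0 ?subr_gt0// subr_lt0; apply: lo; lra.
have [x11||->] := ltgtP x 1; [by apply: up; lra|lra|].
(* A limit at 1 yields only a weak inequality; the intermediate point [w0] supplies the strict
   one. *)
pose w0 := (q + 1) / 2; have qw0 : gap c q < gap c w0 by apply: up; rewrite /w0; lra.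
apply: (lt_le_trans qw0); apply/ler_addgt0Pr => e e0.
(* Since [negentropy w] <= 0 = [negentropy 1], the excess of [gap c w] over [gap c 1] is at most c w
   (1 - w) <= c (1 - w), which this choice makes at most e / 2. *)
pose w := Num.max w0 (1 - e / c / 2).
have w1 : w < 1.
  by rewrite gt_max /w0; apply/andP; split; [lra|rewrite gtrDl oppr_lt0 !divr_gt0].
have w0w : w0 <= w by rewrite le_max lexx.
have we : 1 - w <= e / c / 2 by rewrite lerBlDr -lerBlDl le_max lexx orbT.
have gw : gap c w0 <= gap c w.
  move: w0w; rewrite le_eqVlt => /orP[/eqP -> //|w0w].
  by apply/ltW/up => //; rewrite /w0; lra.
apply: (le_trans gw).
have q12 : 2^-1 <= w by apply: le_trans w0w; rewrite /w0; lra.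
have : negentropy w <= 0 by apply: negentropy_le0; lra.
have : c * (1 - w) <= e / 2.
  by rewrite mulrC -ler_pdivlMr// mulrAC.
rewrite /gap negentropy1; nra.
Qed.

(** * The critical value c_p and the minimizers of [gap] *)

Lemma critical_c_half : critical_c 2^-1 = 2 :> R.
Proof. by rewrite /critical_c eqxx. Qed.

(** This makes p a critical point of [gap (critical_c p)]. At p = 1/2 both sides vanish, so the
    equation does not determine the value there. *)
Lemma critical_c_logit p : 0 < p < 1 ->
  critical_c p * (2 * p - 1) = logit p.
Proof.
move=> /andP[p0 p1]; rewrite /critical_c; case: eqP => [->|/eqP pn].
  by rewrite logit_half; field.
rewrite logit_div// divfK//; apply: contra_neq pn => h; lra.
Qed.

Lemma critical_c_onem p : 0 < p < 1 -> critical_c (1 - p) = critical_c p.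
Proof.
move=> p01; have [->|pn] := eqVneq p 2^-1; first by congr critical_c; field.
have h1 := critical_c_logit p p01.
have h2 : critical_c (1 - p) * (2 * (1 - p) - 1) = logit (1 - p).
  by apply: critical_c_logit; lra.
have p2 : 2 * p - 1 != 0 by apply: contra_neq pn => h; lra.
apply: (mulIf p2); rewrite h1; rewrite logit_onem in h2; nra.
Qed.

Lemma critical_c_gt0 p : 0 < p < 1 -> 0 < critical_c p.
Proof.
wlog p2 : p / 2^-1 <= p => [h|] p01.
  have [|/ltW pn] := leP 2^-1 p; first by move=> ?; apply: h.
  by rewrite -critical_c_onem//; apply: h; lra.
move: p2; rewrite le_eqVlt => /orP[/eqP <-|p2]; first by rewrite critical_c_half.
have := logit_gt_tangent p; rewrite -critical_c_logit//.
have -> : 2^-1 < p < 1 by lra.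
move=> /(_ isT) h; have : 0 < critical_c p * (2 * p - 1) by lra.
by rewrite pmulr_lgt0//; lra.
Qed.

(** Reflection about 1/2 reduces to p and x in the right half. There [critical_c_logit] identifies 2
    c_p as the chord slope of [logit] from 1/2 to p, so the monotonicity of chord slopes gives the
    sign of the derivative on each side of p. *)
Lemma gap_min p x : 0 < p < 1 -> 0 <= x <= 1 -> x != p -> x != 1 - p ->
  gap (critical_c p) p < gap (critical_c p) x.
Proof.
wlog p2 : p / 2^-1 <= p => [h|] p01.
  have [|/ltW pn] := leP 2^-1 p; first by move=> ?; apply: h.
  move=> x01 xp xp'; rewrite -critical_c_onem// -[ltLHS]gap_onem.
  by apply: h => //; rewrite ?subKr//; lra.
wlog x2 : x / 2^-1 <= x => [h|] x01 xp xp'.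
  have [|/ltW xn] := leP 2^-1 x; first by move=> ?; apply: h.
  rewrite -[ltRHS]gap_onem; apply: h => //; first by lra.
  - by lra.
  - by apply: contra_neq xp' => <-; rewrite subKr.
  - by apply: contra_neq xp => h; lra.
apply: gap_min_ge_half => //; [exact: critical_c_gt0|lra| | |lra].
- move=> w w2 wp; have [_ p1] := andP p01; have := logit_slope_lt w p w2 wp p1.
  rewrite -(critical_c_logit p p01) => h.
  have p0 : 0 < p - 2^-1 by lra.
  rewrite -(ltr_pM2r p0); apply: (lt_le_trans h); lra.
(* For p = 1/2 the chord degenerates to the tangent: with c = 2 the line c (2 w - 1) is 4 (w -
   1/2). *)
- move=> w pw w1; move: p2; rewrite le_eqVlt => /orP[/eqP e|p2].
    by rewrite -e critical_c_half; have := logit_gt_tangent w; lra.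
  have := logit_slope_lt p w p2 pw w1.
  rewrite -(critical_c_logit p p01) => h.
  have p0 : 0 < p - 2^-1 by lra.
  rewrite -(ltr_pM2r p0); apply: (le_lt_trans _ h); lra.
Qed.

(** * The scalar function f and its maxima on [0,1] *)

Definition point_value alpha beta w : R :=
  alpha * w + beta * w ^+ 2 - 2^-1 * negentropy w.

Lemma is_derive_point_value alpha beta w : 0 < w < 1 ->
  is_derive w 1 (point_value alpha beta)
    (alpha + 2 * beta * w - 2^-1 * logit w).
Proof.
move=> w01; have d1 := is_derive_negentropy w w01.
have d2 : is_derive w 1 (fun y : R => alpha * y + beta * y ^+ 2)
    (alpha + 2 * beta * w).
  by apply: is_derive_eq; rewrite /GRing.scale/=; ring.
have d3 : is_derive w 1 (fun y : R => 2^-1 * negentropy y) (2^-1 * logit w).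
  exact: (is_deriveZ 2^-1 d1).
exact: (is_deriveB d2 d3).
Qed.

Lemma point_value_argmax alpha beta p : 0 < p < 1 ->
  (forall w, 0 <= w <= 1 -> point_value alpha beta w <= point_value alpha beta p) ->
  alpha = 2^-1 * logit p - 2 * beta * p.
Proof.
move=> p01 pmax; have dp := is_derive_point_value alpha beta p p01.
have d0 : is_derive p 1 (point_value alpha beta) 0.
  apply: (@derive1_at_max R (point_value alpha beta) 0 1 p ler01) => [w|//|w].
    rewrite in_itv/= => w01.
    exact: (@ex_derive _ _ _ _ _ _ _ (is_derive_point_value alpha beta w w01)).
  by rewrite in_itv/= => /andP[w0 w1]; apply: pmax; rewrite !ltW.
have := @derive_val _ _ _ _ _ _ _ dp; rewrite (@derive_val _ _ _ _ _ _ _ d0).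
lra.
Qed.

Section CriticalAlpha.
Variables (alpha beta p : R).
Hypothesis p01 : 0 < p < 1.
Hypothesis alphaE : alpha = 2^-1 * logit p - 2 * beta * p.

(* The linear terms cancel because [logit p = c (2 p - 1)] for the critical
   value [c] of [p]. *)
Lemma point_value_gap w : point_value alpha beta p - point_value alpha beta w =
  2^-1 * (gap (critical_c p) w - gap (critical_c p) p)
  + (critical_c p / 2 - beta) * (w - p) ^+ 2.
Proof.
by rewrite alphaE -critical_c_logit// /point_value /gap; field.
Qed.

Lemma gap_ge w : 0 <= w <= 1 -> gap (critical_c p) p <= gap (critical_c p) w.
Proof.
move=> w01; have [->//|wp] := eqVneq w p.
have [->|wp'] := eqVneq w (1 - p); first by rewrite gap_onem.
exact/ltW/gap_min.
Qed.

Lemma point_value_max w : beta <= critical_c p / 2 -> 0 <= w <= 1 ->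
  point_value alpha beta w <= point_value alpha beta p.
Proof.
move=> bc w01; rewrite -subr_ge0 point_value_gap.
by rewrite addr_ge0// mulr_ge0 ?sqr_ge0 ?subr_ge0 ?gap_ge ?invr_ge0.
Qed.

(** In [point_value_gap] strictness comes from the quadratic term when beta is subcritical. When p =
    1/2 it comes from the [gap] term, whose two minimizers p and 1 - p coincide. *)
Lemma point_value_max_strict w :
  beta < critical_c p / 2 \/ beta <= critical_c p / 2 /\ p = 2^-1 ->
  0 <= w <= 1 -> w != p -> point_value alpha beta w < point_value alpha beta p.
Proof.
move=> bc w01 wp; rewrite -subr_gt0 point_value_gap.
case: bc => [bc|[bc p2]].
  rewrite ltr_wpDl ?mulr_ge0 ?subr_ge0 ?gap_ge ?invr_ge0//.
  by rewrite mulr_gt0 ?subr_gt0// exprn_even_gt0//= subr_eq0.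
apply: ltr_pwDl; last by rewrite mulr_ge0 ?sqr_ge0 ?subr_ge0.
apply: mulr_gt0; first by rewrite invr_gt0.
rewrite subr_gt0; apply: gap_min => //.
by apply: contra_neq wp => ->; rewrite p2; lra.
Qed.

(** At the critical beta the quadratic term disappears and only the symmetric [gap] term is left. *)
Lemma point_value_onem : beta = critical_c p / 2 ->
  point_value alpha beta (1 - p) = point_value alpha beta p.
Proof.
by move=> bc; have := point_value_gap (1 - p); rewrite gap_onem bc; lra.
Qed.

(** For p != 1/2 the witness is 1 - p: the [gap] terms cancel and the quadratic coefficient is
    negative. For p = 1/2 this point is p itself, and a nearby point on the right is used
    instead. *)
Lemma point_value_not_max : critical_c p / 2 < beta ->
  exists2 w, 0 <= w <= 1 & point_value alpha beta p < point_value alpha beta w.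
Proof.
move=> bc; have [p2|pn] := eqVneq p 2^-1; last first.
  exists (1 - p); first by move: p01 => /andP[p0 p1]; apply/andP; split; lra.
  rewrite -subr_lt0 point_value_gap gap_onem subrr mulr0 add0r.
  rewrite pmulr_llt0 ?subr_lt0// exprn_even_gt0//=.
  by apply: contra_neq pn => h; lra.
rewrite p2 critical_c_half in bc.
have b1 : 1 < beta by lra.
(* [t ^+ 2 <= (1 - beta^-1) / 4] ensures [(w (1 - w))^-1 <= 4 beta]. *)
pose t := (1 - beta^-1) / 4; pose w := 2^-1 + t.
have bV : beta * beta^-1 = 1 by apply: divff; lra.
have bV0 : 0 < beta^-1 by rewrite invr_gt0; lra.
have bV1 : beta^-1 < 1 by nra.
have t0 : 0 < t by rewrite /t; lra.
have w2 : 2^-1 < w by rewrite /w; lra.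
exists w; first by rewrite /w /t; lra.
have w1 : w < 1 by rewrite /w /t; lra.
have ww : (w * (1 - w))^-1 <= 4 * beta.
  have -> : 4 * beta = (beta^-1 / 4)^-1 by field; lra.
  rewrite lef_pV2 ?posrE; [|by apply: mulr_gt0; lra|by lra].
  by rewrite /w /t; nra.
(* At p = 1/2, taking c = 2 beta absorbs the quadratic term of [point_value_gap]: f(1/2) - f(w) is
   half the increment of [gap (2 * beta)] from 1/2 to w. That increment is negative because the
   chord slope of [logit] stays below 4 beta up to w. *)
have [z|z /andP[z0 zw] e] := @MVT_derivable (gap (2 * beta))
    (fun y => logit y - 2 * beta * (2 * y - 1)) _ _ w2.
  by move=> z01; apply: is_derive_gap; lra.
have [|z' /andP[z0' zz'] ez] := logit_chord z; first by lra.
have zz := @ltf_inv_mul_onem z' w (ltW z0') (lt_trans zz' zw) w1.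
have gneg : gap (2 * beta) w - gap (2 * beta) 2^-1 < 0.
  rewrite e pmulr_llt0 ?subr_gt0// ez.
  have : (z' * (1 - z'))^-1 * (z - 2^-1) < 4 * beta * (z - 2^-1).
    by rewrite ltr_pM2r; lra.
  by lra.
rewrite -subr_lt0 point_value_gap p2 critical_c_half.
move: gneg; rewrite /gap; nra.
Qed.

End CriticalAlpha.

(** Applying ln u < u to u = 1/y gives y log y >= -1. The crude bound suffices for integrability. *)
Lemma negentropy_ge x : 0 <= x <= 1 -> - 2 <= negentropy x.
Proof.
have h y : 0 <= y -> -1 <= y * ln y.
  rewrite le_eqVlt => /orP[/eqP <-|y0]; first by rewrite mul0r lerN10.
  have yV : 0 < y^-1 by rewrite invr_gt0.
  have := ln_sublinear yV; rewrite lnV ?posrE// => /ltW.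
  by rewrite -(ler_pM2l y0) divff ?gt_eqF// mulrN lerNl.
move=> /andP[x0 x1]; have hx := h x x0; have hx' : -1 <= (1 - x) * ln (1 - x).
  by apply: h; rewrite subr_ge0.
by rewrite /negentropy; lra.
Qed.

End Calculus.

(** * Sections and Fubini for bounded kernels on the unit square *)

Section UnitSquare.
Context {R : realType}.

Local Notation T := (measurableTypeR R).
Local Notation lambda := (@lebesgue_measure R).
Local Notation lambda2 := (lambda \x lambda)%E.
Local Notation I := (@unit_interval R : set T).
Local Notation U := (@unit_square R : set (T * T)).

Lemma measurable_unit_interval : measurable I.
Proof. exact: measurable_itv. Qed.

Lemma measurable_unit_square : measurable U.
Proof. by apply: measurableX; exact: measurable_unit_interval. Qed.

Lemma lebesgue_unit_interval : lambda I = 1%E.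
Proof. by rewrite lebesgue_measure_itv/= lte_fin ltr01 sube0. Qed.

Lemma lebesgue_unit_square : lambda2 U = 1%E.
Proof.
rewrite product_measure1E; [|exact: measurable_unit_interval..].
by rewrite -[RHS]mule1; congr (_ * _)%E; exact: lebesgue_unit_interval.
Qed.

Lemma lebesgue_unit_interval_lty : (lambda I < +oo)%E.
Proof. by rewrite lebesgue_unit_interval ltry. Qed.

Lemma lebesgue_unit_square_lty : (lambda2 U < +oo)%E.
Proof. by rewrite lebesgue_unit_square ltry. Qed.

Lemma bounded_integrable d (X : measurableType d) (mu : {measure set X -> \bar R})
    (D : set X) (f : X -> R) (M : R) :
  measurable D -> (mu D < +oo)%E -> measurable_fun D f ->
  (forall x, D x -> `|f x| <= M) -> mu.-integrable D (EFin \o f).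
Proof.
move=> mD muD mf fM; apply: measurable_bounded_integrable => //.
exists M; split; first exact: num_real.
by move=> N MN x Dx; apply: le_trans (fM x Dx) (ltW MN).
Qed.

Section Kernel.
Variables (K : T * T -> R) (M : R).
Hypothesis mK : measurable_fun U K.
Hypothesis KM : forall z, U z -> `|K z| <= M.

Lemma integrable_square : lambda2.-integrable U (EFin \o K).
Proof.
apply: (@bounded_integrable _ _ _ _ _ M) => //.
  exact: measurable_unit_square.
exact: lebesgue_unit_square_lty.
Qed.

Lemma measurable_section x : I x -> measurable_fun I (fun y => K (x, y)).
Proof.
move=> Ix; apply: (measurable_comp measurable_unit_square _ mK).
  by move=> _ [y Iy <-].
by apply: measurable_funTS; exact: pair1_measurable.
Qed.

Lemma integrable_section x : I x ->
  lambda.-integrable I (EFin \o (fun y => K (x, y))).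
Proof.
move=> Ix; apply: (@bounded_integrable _ _ _ _ _ M).
- exact: measurable_unit_interval.
- exact: lebesgue_unit_interval_lty.
- exact: measurable_section.
- by move=> y Iy; apply: KM.
Qed.

Lemma Rintegral_section_bound x : I x ->
  `|\int[lambda]_(y in I) K (x, y)| <= M.
Proof.
move=> Ix; apply: le_trans (le_normr_Rintegral _ (integrable_section x Ix)) _.
  exact: measurable_unit_interval.
rewrite -[leRHS]mulr1.
have <- : fine (lambda I) = 1 by rewrite lebesgue_unit_interval.
rewrite -(Rintegral_cst lambda measurable_unit_interval); apply: le_Rintegral.
- exact: measurable_unit_interval.
- apply: integrable_norm (integrable_section x Ix).
- apply: (@bounded_integrable _ _ _ _ _ `|M|) => //.
  + exact: measurable_unit_interval.
  + exact: lebesgue_unit_interval_lty.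
- by move=> y Iy; apply: KM.
Qed.

(** Extension by zero, so that Fubini's theorem on the whole product space applies. *)
Let Kt : T * T -> \bar R := (EFin \o K) \_ U.

Let integrable_Kt : lambda2.-integrable setT Kt.
Proof.
exact: (integrable_mkcond _ measurable_unit_square).1 integrable_square.
Qed.

Let fubini_KtE x : fubini_F lambda Kt x =
  ((fun x => \int[lambda]_(y in I) (K (x, y))%:E)%E \_ I) x.
Proof.
rewrite /fubini_F /Kt patchE; case: ifPn => [/set_mem Ix|/negP Ix].
  rewrite [RHS]integral_mkcond; apply: eq_integral => y _.
  rewrite !patchE; congr (if _ then _ else _).
  by apply/idP/idP => /set_mem; [case=> _ /= Iy|move=> Iy]; apply/mem_set.
rewrite integral0_eq// => y _; rewrite patchE; case: ifPn => // /set_mem[/= ? _].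
by case: Ix; apply/mem_set.
Qed.

Lemma measurable_Rintegral_section :
  measurable_fun I (fun x => \int[lambda]_(y in I) K (x, y)).
Proof.
have mF := measurable_fubini_F integrable_Kt.
pose g : T -> \bar R := (fun x => \int[lambda]_(y in I) (K (x, y))%:E)%E.
have mg : measurable_fun I g.
  apply/(measurable_restrictT _ measurable_unit_interval).
  by move: mF; congr measurable_fun; apply/funext => x; exact: fubini_KtE.
exact: (measurableT_comp (fine_measurable measurableT) mg).
Qed.

Lemma Rintegral_section_section :
  \int[lambda]_(x in I) \int[lambda]_(y in I) K (x, y) = \int[lambda2]_(z in U) K z.
Proof.
congr fine; rewrite [RHS]integral_mkcond -(integral12_prod_meas1 integrable_Kt).
rewrite [LHS]integral_mkcond; apply: eq_integral => x _.
rewrite fubini_KtE !patchE; case: ifPn => // /set_mem Ix.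
(* The inner integral of a bounded section is finite, so passing through [fine] loses nothing. *)
rewrite fineK//; apply: integrable_fin_num; first exact: measurable_unit_interval.
exact: integrable_section.
Qed.

End Kernel.
End UnitSquare.

(** * From the scalar function to graphons *)

Section Graphons.
Context {R : realType}.

Local Notation T := (measurableTypeR R).
Local Notation lambda := (@lebesgue_measure R).
Local Notation lambda2 := (lambda \x lambda)%E.
Local Notation I := (@unit_interval R : set T).
Local Notation U := (@unit_square R : set (T * T)).

Lemma measurable_negentropy : measurable_fun setT (@negentropy R).
Proof.
have m1 : measurable_fun setT (fun x : R => 1 - x).
  by apply: measurable_funB; [exact: measurable_cst|exact: measurable_id].
have mln := @measurable_ln R.
apply: measurable_funD; apply: measurable_funM => //.
exact: (measurableT_comp mln m1).
Qed.

Lemma graphon_cst c : 0 <= c <= 1 -> graphon (fun=> c : R).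
Proof. by split => //; exact: measurable_cst. Qed.

Lemma Rintegral_square_cst (c : R) : \int[lambda2]_(z in U) c = c.
Proof.
rewrite Rintegral_cst; last exact: measurable_unit_square.
by rewrite -[RHS]mulr1; congr (_ * _); exact: (congr1 fine lebesgue_unit_square).
Qed.

Lemma Rintegral_interval_cst (c : R) : \int[lambda]_(z in I) c = c.
Proof.
rewrite Rintegral_cst; last exact: measurable_unit_interval.
by rewrite -[RHS]mulr1; congr (_ * _); exact: (congr1 fine lebesgue_unit_interval).
Qed.

Lemma Phi_cst alpha beta (c : R) :
  Phi alpha beta (fun=> c) = point_value alpha beta c.
Proof.
rewrite /Phi /edge_density /two_star_density /entropy /point_value.
rewrite !Rintegral_square_cst; congr (_ + _ * _ - _).
rewrite -[RHS]Rintegral_interval_cst; apply: eq_Rintegral => x _.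
by congr (_ ^+ 2); exact: Rintegral_interval_cst.
Qed.

Section OneGraphon.
Variable W : R * R -> R.
Hypothesis gW : graphon W.

Lemma measurable_graphon : measurable_fun U W.
Proof. by case: gW. Qed.

Lemma graphon_norm_le1 z : U z -> `|W z| <= 1.
Proof. by case: gW => _ _ h /h /andP[w0 w1]; rewrite ger0_norm. Qed.

Lemma graphon_sqr_norm_le1 z : U z -> `|W z ^+ 2| <= 1.
Proof. by move=> /graphon_norm_le1 h; rewrite normrX expr_le1. Qed.

Lemma measurable_graphon_sqr : measurable_fun U (fun z => W z ^+ 2).
Proof. exact: measurable_funX measurable_graphon. Qed.

Lemma integrable_graphon : lambda2.-integrable U (EFin \o W).
Proof. exact: integrable_square _ _ measurable_graphon graphon_norm_le1. Qed.

Lemma integrable_graphon_sqr :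
  lambda2.-integrable U (EFin \o (fun z => W z ^+ 2)).
Proof. exact: integrable_square _ _ measurable_graphon_sqr graphon_sqr_norm_le1. Qed.

Lemma integrable_graphon_negentropy :
  lambda2.-integrable U (EFin \o (fun z => negentropy (W z))).
Proof.
apply: (@integrable_square _ _ 2).
  exact: measurableT_comp measurable_negentropy measurable_graphon.
case: gW => _ _ h z /h w01; rewrite ler_norml negentropy_ge//=.
by apply: le_trans (negentropy_le0 _ w01) _.
Qed.

(* Jensen's inequality on each section, from [W ^+ 2 >= 2 d W - d ^+ 2]. *)
Lemma two_star_density_le :
  two_star_density W <= \int[lambda2]_(z in U) W z ^+ 2.
Proof.
rewrite -(Rintegral_section_section _ _ measurable_graphon_sqr graphon_sqr_norm_le1).
have md := measurable_Rintegral_section _ _ measurable_graphon graphon_norm_le1.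
have mI := @measurable_unit_interval R.
apply: le_Rintegral => //.
- apply: (@bounded_integrable _ _ _ _ _ _ 1) => //.
  + exact: lebesgue_unit_interval_lty.
  + exact: measurable_funX.
  + move=> x Ix; rewrite normrX expr_le1//.
    exact: Rintegral_section_bound _ _ measurable_graphon graphon_norm_le1 x Ix.
- apply: (@bounded_integrable _ _ _ _ _ _ 1) => //.
  + exact: lebesgue_unit_interval_lty.
  + exact: measurable_Rintegral_section _ _ measurable_graphon_sqr graphon_sqr_norm_le1.
  + exact: Rintegral_section_bound _ _ measurable_graphon_sqr graphon_sqr_norm_le1.
move=> x Ix.
have iW := integrable_section _ _ measurable_graphon graphon_norm_le1 x Ix.
have iW2 := integrable_section _ _ measurable_graphon_sqr graphon_sqr_norm_le1 x Ix.
set d := \int[lambda]_(y in I) W (x, y).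
have idW : lambda.-integrable I (EFin \o (fun y => 2 * d * W (x, y))).
  exact: (integrableZl mI _ iW).
have icst : lambda.-integrable I (EFin \o (fun _ => d ^+ 2)).
  apply: (@bounded_integrable _ _ _ _ _ _ `|d ^+ 2|) => //.
  exact: lebesgue_unit_interval_lty.
(* As d is the mean of the section, the right side integrates to 2 d^2 - d^2. *)
have -> : d ^+ 2 = \int[lambda]_(y in I) (2 * d * W (x, y) - d ^+ 2).
  rewrite RintegralB// RintegralZl// Rintegral_interval_cst -/d; ring.
apply: le_Rintegral => //; first exact: (integrableB mI idW icst).
by move=> y _; rewrite -subr_ge0; have := sqr_ge0 (W (x, y) - d); lra.
Qed.

Let mU := @measurable_unit_square R.

Let integrable_edge_term alpha :
  lambda2.-integrable U (EFin \o (fun z => alpha * W z)).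
Proof. exact: (integrableZl mU _ integrable_graphon). Qed.

Let integrable_star_term beta :
  lambda2.-integrable U (EFin \o (fun z => beta * W z ^+ 2)).
Proof. exact: (integrableZl mU _ integrable_graphon_sqr). Qed.

Let integrable_entropy_term :
  lambda2.-integrable U (EFin \o (fun z => 2^-1 * negentropy (W z))).
Proof. exact: (integrableZl mU _ integrable_graphon_negentropy). Qed.

Let integrable_energy_terms alpha beta :
  lambda2.-integrable U (EFin \o (fun z => alpha * W z + beta * W z ^+ 2)).
Proof.
exact: (integrableD mU (integrable_edge_term alpha) (integrable_star_term beta)).
Qed.

Lemma integrable_point_value alpha beta :
  lambda2.-integrable U (EFin \o (fun z => point_value alpha beta (W z))).
Proof.
exact: (integrableB mU (integrable_energy_terms alpha beta) integrable_entropy_term).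
Qed.

(** Expanded by linearity, the two sides differ only in the beta term, where the sign of beta lets
    [two_star_density_le] apply. *)
Lemma Phi_le_Rintegral alpha beta : 0 <= beta ->
  Phi alpha beta W <= \int[lambda2]_(z in U) point_value alpha beta (W z).
Proof.
move=> b0.
rewrite (RintegralB mU (integrable_energy_terms _ _) integrable_entropy_term).
rewrite (RintegralD mU (integrable_edge_term _) (integrable_star_term _)).
rewrite (RintegralZl _ mU integrable_graphon).
rewrite (RintegralZl _ mU integrable_graphon_sqr).
rewrite (RintegralZl _ mU integrable_graphon_negentropy).
by rewrite /Phi lerD2r lerD2l; apply: ler_wpM2l => //; exact: two_star_density_le.
Qed.

End OneGraphon.

(** The bound f(V) <= f(p) is integrated over the square, which has measure one. *)
Lemma global_maximizer_cst alpha beta (p : R) : 0 <= beta -> 0 <= p <= 1 ->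
  (forall w, 0 <= w <= 1 -> point_value alpha beta w <= point_value alpha beta p) ->
  global_maximizer alpha beta (fun=> p).
Proof.
move=> b0 p01 pmax; split=> [|V gV]; first exact: graphon_cst.
apply: le_trans (Phi_le_Rintegral V gV alpha beta b0) _.
rewrite Phi_cst -[leRHS]Rintegral_square_cst; apply: le_Rintegral.
- exact: measurable_unit_square.
- exact: integrable_point_value.
- exact: (integrable_point_value _ (graphon_cst _ p01)).
- by case: gV => _ _ h z Uz; apply/pmax/h.
Qed.

(** Constant graphons serve as competitors. *)
Lemma global_maximizer_cst_point_value alpha beta (p w : R) :
  global_maximizer alpha beta (fun=> p) -> 0 <= w <= 1 ->
  point_value alpha beta w <= point_value alpha beta p.
Proof. by move=> [_ h] w01; have := h _ (graphon_cst _ w01); rewrite !Phi_cst. Qed.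

(** For another maximizer V the deficit f(p) - f(V) is nonnegative with integral zero, hence zero
    almost everywhere; strictness of the maximum then gives V = p at those points. *)
Lemma unique_maximizer_cst alpha beta (p : R) : 0 <= beta -> 0 <= p <= 1 ->
  (forall w, 0 <= w <= 1 -> w != p ->
    point_value alpha beta w < point_value alpha beta p) ->
  unique_maximizer alpha beta (fun=> p).
Proof.
move=> b0 p01 pmax.
have pmax' w : 0 <= w <= 1 -> point_value alpha beta w <= point_value alpha beta p.
  by move=> w01; have [->//|wp] := eqVneq w p; exact/ltW/pmax.
split; first exact: global_maximizer_cst.
move=> V [gV Vmax]; have mU := @measurable_unit_square R.
have Vle := Phi_le_Rintegral V gV alpha beta b0.
(* Maximality of V, tested against the constant p, gives f(p) <= Phi(V) <= integral of f(V). *)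
have := le_trans (Vmax _ (graphon_cst _ p01)) Vle; rewrite Phi_cst => pV.
have iV := integrable_point_value V gV alpha beta.
have ip := integrable_point_value _ (graphon_cst _ p01) alpha beta.
pose D z := point_value alpha beta p - point_value alpha beta (V z).
have iD : lambda2.-integrable U (EFin \o D) by exact: (integrableB mU ip iV).
have D0 z : U z -> 0 <= D z.
  by case: gV => _ _ h Uz; rewrite subr_ge0; exact/pmax'/h.
have D0int : \int[lambda2]_(z in U) D z = 0.
  apply/eqP; rewrite eq_le Rintegral_ge0// andbT.
  by rewrite RintegralB// Rintegral_square_cst subr_le0.
have : ae_eq lambda2 U (EFin \o D) (cst 0%E).
  have mD := measurable_int _ iD.
  have [h _] := ae_eq_integral_abs lambda2 mU mD; apply: h => {mD}.
  transitivity (\int[lambda2]_(z in U) (D z)%:E)%E.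
    by apply: eq_integral => z /set_mem Uz /=; rewrite ger0_norm ?D0.
  rewrite -[LHS]fineK; first by congr EFin.
  exact: (integrable_fin_num mU iD).
apply: filterS => z /= Dz Uz; have {Dz} [Dz] := Dz Uz.
apply/eqP/contraT => Vp; have : 0 < D z.
  by rewrite subr_gt0; apply: pmax => //; case: gV => _ _; apply.
by rewrite Dz ltxx.
Qed.

(** Distinct constants disagree on the whole square, which has measure one and so is not
    negligible. *)
Lemma graphon_eq_cst (a b : R) : graphon_eq (fun=> a) (fun=> b) -> a = b.
Proof.
move=> ab; apply: contrapT => neq_ab.
have : lambda2.-negligible U.
  by apply: negligibleS ab => z Uz /=; apply/not_implyP.
move=> /(negligibleP _ measurable_unit_square) U0.
by have /eqP := etrans (esym lebesgue_unit_square) U0; rewrite onee_eq0.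
Qed.

End Graphons.

Theorem propositionA1 (R : realType) (p beta : R)
    (hp0 : 0 < p) (hp1 : p < 1) (hbeta : 0 <= beta) :
  let alpha_p : R := 2^-1 * ln (p / (1 - p)) - 2 * beta * p in
  let W_p : R * R -> R := fun=> p in
  (forall alpha : R, global_maximizer alpha beta W_p -> alpha = alpha_p) /\
  [/\ beta < critical_c p / 2 -> unique_maximizer alpha_p beta W_p,
      beta = critical_c p / 2 ->
        global_maximizer alpha_p beta W_p /\
        (unique_maximizer alpha_p beta W_p <-> p = 2^-1) &
      critical_c p / 2 < beta -> ~ global_maximizer alpha_p beta W_p].
Proof.
move=> alpha_p W_p; have p01 : 0 < p < 1 by rewrite hp0.
have p01' : 0 <= p <= 1 by rewrite !ltW.
have alphaE : alpha_p = 2^-1 * logit p - 2 * beta * p.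
  by rewrite /alpha_p logit_div.
split=> [alpha pmax|]; first rewrite alphaE.
  apply: point_value_argmax => // w.
  exact: global_maximizer_cst_point_value.
split=> [bc|bc|bc pmax].
- apply: unique_maximizer_cst => // w; apply: point_value_max_strict => //.
  by left.
- have pmax : global_maximizer alpha_p beta W_p.
    apply: global_maximizer_cst => // w; apply: point_value_max => //.
    by rewrite bc.
  split=> //; split=> [[_ uniq]|p2].
    have q01 : 0 <= 1 - p <= 1 by lra.
    (* At the critical beta the constant 1 - p is a maximizer too, so uniqueness forces 1 - p =
       p. *)
    have qmax : global_maximizer alpha_p beta (fun=> 1 - p).
      apply: global_maximizer_cst => // w w01.
      rewrite (point_value_onem alpha_p beta p)//.
      exact: global_maximizer_cst_point_value.
    by have := graphon_eq_cst _ _ (uniq _ qmax); lra.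
  apply: unique_maximizer_cst => // w; apply: point_value_max_strict => //.
  by right; rewrite bc.
have [w w01] := point_value_not_max alpha_p beta p p01 alphaE bc.
by rewrite ltNge (global_maximizer_cst_point_value _ _ _ _ pmax w01).
Qed.
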